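(* Let $r\ge 3$ and $e\in\{4,5,7,8\}$. For sufficiently large $n$ it holds that $f_r(n,e(r-2)+3,e)>n^{2-o(1)}$.
   Context: For integers $r,v,e$, an $r$-uniform hypergraph is called $\mathcal{G}_r(v,e)$-free if the union of any $e$ distinct edges has at least $v+1$ vertices. $f_r(n,v,e)$ denotes the maximum number of edges in a $\mathcal{G}_r(v,e)$-free $r$-uniform hypergraph on $n$ vertices. The $o(1)$ term tends to $0$ as $n\to\infty$. *)

(* Defs.v *)
From mathcomp Require Import all_boot.

Set Implicit Arguments.
Unset Strict Implicit.
Unset Printing Implicit Defensive.

(* A hypergraph on the vertex set V is identified with its set of edges. *)
Definition hypergraph (V : finType) := {set {set V}}.

Definition uniform (V : finType) (r : nat) (H : hypergraph V) : bool :=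
  [forall A in H, #|A| == r].

Definition Gfree (V : finType) (v e : nat) (H : hypergraph V) : bool :=
  [forall S : {set {set V}},
     (S \subset H) && (#|S| == e) ==> (v + 1 <= #|cover S|)].

(* The empty hypergraph is always admissible, so this is a maximum over a
   nonempty family. *)
Definition turan (r n v e : nat) : nat :=
  \max_(H : {set {set 'I_n}} | uniform r H && Gfree v e H) #|H|.

(* Main.v *)
Require Import Defs.
From mathcomp Require Import all_boot all_order all_algebra.
From mathcomp Require Import all_classical all_reals all_analysis.
From mathcomp Require Import zify ring lra.

(* The edges are "lines" (x, m), where x and m are d-tuples of integer
   polynomials in t_1, ..., t_r of bounded degree and coefficients; the i-th
   vertex of (x, m) is x + t_i m.  Only directions m on a common sphere are
   kept: for each of finitely many substitutions of integers for the t_i, one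
   for each ordering of the variables, the squared norm of m is prescribed
   (popular fiber, as in Behrend's construction).  Around a closed quadrilateral
   of lines meeting at p_1, ..., p_4 the directions satisfy
     (p_4 - p_1) m_1 = (p_2 - p_1) m_2 + (p_3 - p_2) m_3 + (p_4 - p_3) m_4.
   If the heights are distinct, the substitution can be chosen to order them as
   p_1 < p_2 < p_3 < p_4; then m_1 is a convex combination of points of its own
   sphere and the lines coincide.  Hence two lines share at most one vertex,
   and there are no triangles and no quadrilaterals with four distinct heights.

   For e lines, consider the graph of their intersections, labelled by heights.
   It is triangle-free and every 4-cycle has two equal opposite labels, which
   excludes K_{2,4} and K_{4,4} minus a matching of size 3.  Expanding around a
   vertex of maximal degree, such a graph has at most 2e - 4 edges when
   e = 4, 5, 7, 8 (K_{3,3} remains possible, which is why 6 is absent), so that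
   the union of e lines has at least er - (2e - 4) vertices. *)

Set Implicit Arguments.
Unset Strict Implicit.
Unset Printing Implicit Defensive.

(** * Labelled triangle-free graphs *)

Section Graph.
Variables (I : finType) (C : eqType) (adj : rel I) (c : I -> I -> C).
Hypothesis adjC : symmetric adj.
Hypothesis cC : forall j k, c j k = c k j.
Hypothesis tri : forall j k l, adj j k -> adj k l -> adj l j -> False.
Hypothesis quad_neq : forall j k l m, j != l -> k != m ->
  adj j k -> adj k l -> adj l m -> adj m j -> c j k <> c k l.
Hypothesis quad_opp : forall j k l m, j != l -> k != m ->
  adj j k -> adj k l -> adj l m -> adj m j -> c j k = c l m \/ c k l = c m j.

Let nb u := [set w | adj u w].

(** Each pair [a], [b] of common neighbours needs [c u a = c w b] or [c w a = c u b]. Labels at [w]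
    are distinct, so each [a] has at most one [b] with [c u a = c w b]: four vertices yield at most
    4 such equalities, but they form 6 pairs. *)
Lemma card_common_nb u w : u != w -> #|nb u :&: nb w| <= 3.
Proof.
move=> uw; rewrite leqNgt; apply/negP => gt3.
have [x /= xA | noA] := pickP (mem (nb u :&: nb w)); last by rewrite (eq_card0 noA) in gt3.
move: gt3; rewrite (cardsD1 x) xA ltnS.
case/card_gt2P => y [z [t [[yA zA tA] [yz zt ty]]]].
have Q a b : a \in nb u :&: nb w -> b \in nb u :&: nb w -> a != b ->
  [/\ c u a <> c u b, c w a <> c w b & (c u a = c w b \/ c w a = c u b)].
  rewrite !inE => /andP[ua wa] /andP[ub wb] ab.
  have [au aw bu bw] : [/\ adj a u, adj a w, adj b u & adj b w].
    by rewrite !(adjC _ u) !(adjC _ w).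
  split.
  - by rewrite (cC u a); apply: (quad_neq (m := w)).
  - by rewrite (cC w a); apply: (quad_neq (m := u)) => //; rewrite eq_sym.
  - have := quad_opp (j := u) (k := a) (l := w) (m := b) uw ab ua aw wb bu.
    by rewrite (cC a w) (cC b u).
move: yA zA tA; rewrite !finset.in_setD1 ![_ == x]eq_sym => /andP[yx yA] /andP[zx zA] /andP[tx tA].
have [? ? ?] := Q x y xA yA yx.
have [? ? ?] := Q x z xA zA zx.
have [? ? ?] := Q x t xA tA tx.
have [? ? ?] := Q y z yA zA yz.
have [? ? ?] := Q z t zA tA zt.
have [? ? ?] := Q t y tA yA ty.
repeat match goal with H : _ \/ _ |- _ => case: H => ?; try congruence end.
Qed.

(** By the same count, the labels at each [w] are a cyclic shift of the labels at [u] on the same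
    three vertices. On the two [n]'s that a pair of [w]'s shares, every choice of shifts violates
    the 4-cycle conditions. *)
Lemma no_K44_minus_matching u w1 w2 w3 n1 n2 n3 n4 :
  uniq [:: u; w1; w2; w3] -> uniq [:: n1; n2; n3; n4] ->
  all (adj u) [:: n1; n2; n3; n4] -> all (adj w1) [:: n2; n3; n4] ->
  all (adj w2) [:: n1; n3; n4] -> all (adj w3) [:: n1; n2; n4] -> False.
Proof.
have Q a b x y : a != b -> x != y -> adj a x -> adj a y -> adj b x -> adj b y ->
  [/\ c a x <> c a y, c b x <> c b y, c a x <> c b x, c a y <> c b y &
      (c a x = c b y \/ c b x = c a y)].
  move=> ab xy ax ay bx by_.
  have [xa ya xb yb] : [/\ adj x a, adj y a, adj x b & adj y b].
    by rewrite !(adjC _ a) !(adjC _ b).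
  split.
  - by rewrite (cC a x); apply: (quad_neq (m := b)).
  - by rewrite (cC b x); apply: (quad_neq (m := a)) => //; rewrite eq_sym.
  - by rewrite (cC b x); apply: (quad_neq (m := y)).
  - by rewrite (cC b y); apply: (quad_neq (m := x)) => //; rewrite eq_sym.
  - have := quad_opp (j := a) (k := x) (l := b) (m := y) ab xy ax xb by_ ya.
    by rewrite (cC x b) (cC y a).
rewrite /= !inE !negb_or !andbT.
move=> /and3P[/and3P[u1 u2 u3] /andP[w12 w13] w23].
move=> /and3P[/and3P[n12 n13 n14] /andP[n23 n24] n34].
move=> /and4P[un1 un2 un3 un4] /and3P[a12 a13 a14] /and3P[a21 a23 a24] /and3P[a31 a32 a34].
have [? ? ? ? ?] := Q _ _ _ _ u1 n23 un2 un3 a12 a13.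
have [? ? ? ? ?] := Q _ _ _ _ u1 n24 un2 un4 a12 a14.
have [? ? ? ? ?] := Q _ _ _ _ u1 n34 un3 un4 a13 a14.
have [? ? ? ? ?] := Q _ _ _ _ u2 n13 un1 un3 a21 a23.
have [? ? ? ? ?] := Q _ _ _ _ u2 n14 un1 un4 a21 a24.
have [? ? ? ? ?] := Q _ _ _ _ u2 n34 un3 un4 a23 a24.
have [? ? ? ? ?] := Q _ _ _ _ u3 n12 un1 un2 a31 a32.
have [? ? ? ? ?] := Q _ _ _ _ u3 n14 un1 un4 a31 a34.
have [? ? ? ? ?] := Q _ _ _ _ u3 n24 un2 un4 a32 a34.
have [? ? ? ? ?] := Q _ _ _ _ w12 n34 a13 a14 a23 a24.
have [? ? ? ? ?] := Q _ _ _ _ w13 n24 a12 a14 a32 a34.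
have [? ? ? ? ?] := Q _ _ _ _ w23 n14 a21 a24 a31 a34.
repeat match goal with H : _ \/ _ |- _ => case: H => ?; try congruence end.
Qed.

Let W u := ~: (u |: nb u).

Let adjI x : adj x x = false.
Proof. by apply/negP => xx; apply: (tri xx xx xx). Qed.

(** Since [nb u] spans no edge, an edge meets [u], joins [nb u] to [W u], or lies inside [W u]; the
    last double sum already counts ordered pairs. *)
Lemma sum_deg_split u : \sum_w #|nb w| =
  #|nb u|.*2 + (\sum_(w in W u) #|nb w :&: nb u|).*2 + \sum_(w in W u) \sum_(x in W u) adj w x.
Proof.
have uN : u \notin nb u by rewrite inE adjI.
have splitI (F : I -> nat) : \sum_w F w = F u + \sum_(w in nb u) F w + \sum_(w in W u) F w.
  rewrite (bigID (mem (u |: nb u))) /= big_setU1 //=; congr (_ + _).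
  by apply: eq_bigl => w; rewrite !inE.
have cardE w (A : {set I}) : #|nb w :&: A| = \sum_(x in A) adj w x.
  rewrite -sum1_card big_mkcond [RHS]big_mkcond.
  by apply: eq_bigr => x _; rewrite !inE; case: adj; case: (x \in A).
have degE w : #|nb w| = adj w u + #|nb w :&: nb u| + \sum_(x in W u) adj w x.
  by rewrite cardE -splitI -(finset.setIT (nb w)) cardE; apply: eq_bigl => x; rewrite inE.
have exch : \sum_(w in nb u) \sum_(x in W u) adj w x = \sum_(w in W u) #|nb w :&: nb u|.
  rewrite exchange_big; apply: eq_bigr => w _; rewrite cardE.
  by apply: eq_bigr => x _; rewrite adjC.
have sumN : \sum_(w in nb u) #|nb w| = #|nb u| + \sum_(w in W u) #|nb w :&: nb u|.
  rewrite -exch -sum1_card -big_split; apply: eq_bigr => w; rewrite inE => uw.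
  rewrite degE adjC uw; congr (_ + _); rewrite [#|_|]eq_card0 // => x; rewrite !inE.
  by apply/negP => /andP[wx ux]; apply: (tri uw wx); rewrite adjC.
have sumW : \sum_(w in W u) #|nb w| =
    \sum_(w in W u) #|nb w :&: nb u| + \sum_(w in W u) \sum_(x in W u) adj w x.
  rewrite -big_split; apply: eq_bigr => w; rewrite !inE negb_or => /andP[_ uw].
  by rewrite degE adjC (negPf uw).
by rewrite splitI sumN sumW; lia.
Qed.

Let codeg u w := #|nb w :&: nb u|.

Lemma adj_disjoint u x y : adj x y -> codeg u x + codeg u y <= #|nb u|.
Proof.
move=> xy; rewrite -leq_subRL ?subset_leq_card ?finset.subsetIr // /codeg.
rewrite -(cardsDS (finset.subsetIr _ _)) subset_leq_card //; apply/fintype.subsetP => z.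
rewrite !inE => /andP[yz ->]; rewrite !andbT; apply/negP => xz.
by apply: (tri xy yz); rewrite adjC.
Qed.

(** Serves seven vertices with maximal degree 4: separate bounds would give 12 + 2, one edge too
    many, but adjacent [x] and [y] have disjoint neighbourhoods. *)
Lemma two_others_le u x y : x != y -> u != x -> u != y -> #|nb u| <= 4 ->
  (codeg u x + codeg u y).*2 + (adj x y).*2 <= 12.
Proof.
move=> xy ux uy u4.
have [xy1|nxy] := boolP (adj x y); first by have := adj_disjoint u xy1; rewrite /=; lia.
have := @card_common_nb x u; have := @card_common_nb y u.
rewrite eq_sym uy eq_sym ux => /(_ isT) ? /(_ isT) ?.
by rewrite /codeg; lia.
Qed.

(** A sum of 7 forces the codegrees 3, 1, 3. Then [x] and [z] both see [y] and the three vertices of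
    [nb u] outside [nb y], which makes four common neighbours. *)
Lemma path_others_lt u x y z : u != x -> u != z -> x != z -> #|nb u| = 4 ->
  adj x y -> adj y z -> codeg u x + codeg u y + codeg u z < 7.
Proof.
move=> ux uz xz u4 xy yz.
have xle := @card_common_nb x u; rewrite eq_sym ux in xle; have {}xle := xle isT.
have zle := @card_common_nb z u; rewrite eq_sym uz in zle; have {}zle := zle isT.
have d1 := adj_disjoint u xy; have d2 := adj_disjoint u yz.
rewrite ltnNge; apply/negP => ge7.
have [ax ay az] : [/\ codeg u x = 3, codeg u y = 1 & codeg u z = 3].
  by split; rewrite /codeg in d1 d2 ge7 *; lia.
have sub w : adj w y -> codeg u w = 3 -> nb w :&: nb u = nb u :\: nb y.
  move=> wy aw; apply/eqP; rewrite eqEcard; apply/andP; split.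
    apply/fintype.subsetP => v; rewrite !inE => /andP[wv ->]; rewrite andbT; apply/negP => yv.
    by apply: (tri wy yv); rewrite adjC.
  by rewrite cardsD finset.setIC -/(codeg u y) -/(codeg u w) ay aw u4.
have ex := sub x xy ax; have ez := sub z; rewrite adjC in ez; have {}ez := ez yz az.
have := card_common_nb xz; rewrite leqNgt => /negP; apply.
have yu : adj u y = false.
  apply/negP => uy; have /card_gt0P[v] : 0 < codeg u y by rewrite ay.
  by rewrite !inE => /andP[yv uv]; apply: (tri uy yv); rewrite adjC.
have <- : #|y |: (nb u :\: nb y)| = 4 by rewrite cardsU1 -ex -/(codeg u x) ax !inE yu andbF.
apply: subset_leq_card; apply/fintype.subsetP => v; rewrite in_setU1 => /orP[/eqP->|].
  by rewrite !inE xy adjC yz.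
move=> vD; have := vD; rewrite -{1}ex inE => /andP[vx _].
by move: vD; rewrite -ez inE => /andP[vz _]; rewrite inE vx.
Qed.

(** With sum 9, each of [x], [y], [z] misses exactly one neighbour of [u]. If two missed vertices
    coincide, two vertices of [nb u] see all of [u], [x], [y], [z]; otherwise K_{4,4} minus a
    matching appears. *)
Lemma nonadjacent_others_lt u x y z : #|nb u| = 4 -> W u = x |: [set y; z] ->
  x != y -> y != z -> x != z ->
  adj x y = false -> adj y z = false -> adj x z = false -> codeg u x + codeg u y + codeg u z < 9.
Proof.
move=> u4 Wu xy yz xz nxy nyz nxz.
have [ux uy uz] : [/\ x != u, y != u & z != u].
  by split; move: Wu => /setP; [move/(_ x)|move/(_ y)|move/(_ z)];
     rewrite !inE eqxx ?orbT negb_or => /andP[].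
have xle := card_common_nb ux; have yle := card_common_nb uy; have zle := card_common_nb uz.
rewrite ltnNge; apply/negP => ge9.
have [ax ay az] : [/\ codeg u x = 3, codeg u y = 3 & codeg u z = 3].
  by split; rewrite /codeg in ge9 *; lia.
have miss w : codeg u w = 3 -> exists2 n, n \in nb u & forall v, v \in nb u -> v != n -> adj w v.
  move=> aw; have /eqP/cards1P[n nE] : #|nb u :\: nb w| = 1.
    by rewrite cardsD finset.setIC -/(codeg u w) aw u4.
  have : n \in nb u :\: nb w by rewrite nE inE.
  rewrite inE => /andP[_ nu]; exists n => // v vu vn.
  by move: vn; rewrite -finset.in_set1 -nE inE vu andbT negbK inE.
have [nx nxu adjx] := miss x ax; have [ny nyu adjy] := miss y ay; have [nz nzu adjz] := miss z az.
have far v w : v \in nb u -> w \in nb u -> v != w -> adj x v -> adj x w -> adj y v -> adj y w ->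
    adj z v -> adj z w -> False.
  rewrite !inE => uv uw vw xv xw yv yw zv zw.
  have := card_common_nb vw; rewrite leqNgt => /negP; apply.
  have <- : #|u |: (x |: [set y; z])| = 4.
    rewrite !cardsU1 cards1 !inE !negb_or ![u == _]eq_sym ux uy uz xy xz yz.
    by [].
  apply: subset_leq_card; apply/fintype.subsetP => t; rewrite !inE !(adjC _ t).
  by move=> /or4P[] /eqP->; apply/andP.
have cardD p (A : {set I}) : #|A| <= #|A :\ p|.+1.
  by rewrite (cardsD1 p A); case: (p \in A); rewrite // ltnW.
have pick2 p q : nx \in [:: p; q] -> ny \in [:: p; q] -> nz \in [:: p; q] -> False.
  move=> xpq ypq zpq.
  have /card_gt1P[v [w [vA wA vw]]] : 1 < #|nb u :\ p :\ q|.
    have h : 2 < #|nb u :\ p| by have := cardD p (nb u); rewrite u4.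
    exact: leq_trans h (cardD q _).
  move: vA wA; rewrite !finset.in_setD1 => /and3P[vq vp vu] /and3P[wq wp wu].
  have neq n t : n \in [:: p; q] -> t != q -> t != p -> t != n.
    by rewrite !inE => /orP[] /eqP->.
  by apply: (far v w) => //; [apply: adjx|apply: adjx|apply: adjy|apply: adjy|apply: adjz|apply: adjz]
     => //; apply: neq.
have nxy' : nx != ny by apply/eqP => e; apply: (pick2 nx nz); rewrite !inE ?e eqxx ?orbT.
have nyz' : ny != nz by apply/eqP => e; apply: (pick2 nx nz); rewrite !inE ?e eqxx ?orbT.
have nxz' : nx != nz by apply/eqP => e; apply: (pick2 nx ny); rewrite !inE ?e eqxx ?orbT.
have [n] : exists n, n \in nb u :\ nx :\ ny :\ nz.
  apply/card_gt0P.
  have h : 2 < #|nb u :\ nx| by have := cardD nx (nb u); rewrite u4.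
  have h2 : 1 < #|nb u :\ nx :\ ny| by exact: leq_trans h (cardD ny _).
  exact: leq_trans h2 (cardD nz _).
rewrite !finset.in_setD1 => /and4P[nnz nny nnx nu].
apply: (@no_K44_minus_matching u x y z nx ny nz n).
- by rewrite /= !inE !negb_or ![u == _]eq_sym ux uy uz xy xz yz.
- by rewrite /= !inE !negb_or ![_ == n]eq_sym nnx nny nnz nxy' nxz' nyz'.
- by rewrite /=; move: nxu nyu nzu nu; rewrite !inE => -> -> -> ->.
- by rewrite /= !adjx // eq_sym.
- by rewrite /= !adjy // eq_sym.
- by rewrite /= !adjz // eq_sym.
Qed.

(** The degree sum is twice the number of edges, so this means at most [2 * #|I| - 4] edges. Two
    estimates compete: [#|I| * #|nb u|] for [u] of maximal degree, and [sum_deg_split] with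
    codegrees at most 3. *)
Lemma sum_deg_lt : #|I| \in [:: 4; 5; 7; 8] -> \sum_w #|nb w| < (4 * #|I|) - 6.
Proof.
move=> cI; have /card_gt0P[i0 _] : 0 < #|I| by move: cI; rewrite !inE; lia.
have [u _ umax] := arg_maxnP (fun w => #|nb w|) (erefl true : predT i0).
have sumle : \sum_w #|nb w| <= #|I| * #|nb u|.
  by rewrite -sum_nat_const; apply: leq_sum => w _; apply: umax.
have cW : #|W u| + #|nb u|.+1 = #|I|.
  by have := cardsC (u |: nb u); rewrite cardsU1 inE adjI addnC add1n => <-.
have Wneq w : w \in W u -> w != u by rewrite !inE negb_or => /andP[].
have ale w : w \in W u -> #|nb w :&: nb u| <= 3 by move/Wneq/card_common_nb.
have split := sum_deg_split u.
have S1 : \sum_(w in W u) #|nb w :&: nb u| <= #|W u| * 3.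
  by rewrite -sum_nat_const; apply: leq_sum.
have S2 : \sum_(w in W u) \sum_(x in W u) adj w x <= #|W u| * #|W u|.-1.
  rewrite -sum_nat_const; apply: leq_sum => w wW.
  rewrite (bigD1 w) //= adjI add0n (cardsD1 w) wW /= -sum1_card.
  rewrite (eq_bigl (fun x => x \in W u :\ w)); last by move=> x; rewrite !inE andbC.
  by apply: leq_sum => x _; apply: leq_b1.
(* For the allowed sizes, both estimates fail only when [u] has degree 4 and [W u] has two or three
   elements. *)
have [/andP[/eqP d4 /eqP k2]|nk2] := boolP ((#|nb u| == 4) && (#|W u| == 2)).
  have /cards2P[x [y [xy Wu]]] : #|W u| == 2 by rewrite k2.
  have [xu yu] : x != u /\ y != u by split; apply: Wneq; rewrite Wu !inE eqxx ?orbT.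
  have sum2 (F : I -> nat) : \sum_(w in [set x; y]) F w = F x + F y.
    by rewrite big_setU1 ?inE //= big_set1.
  move: split; rewrite Wu !sum2 !adjI (adjC y) d4 -cW k2 d4.
  have := @two_others_le u x y xy; rewrite eq_sym xu eq_sym yu d4 => /(_ isT isT isT).
  by rewrite /codeg; case: (adj x y) => /=; lia.
have [/andP[/eqP d4 /eqP k3]|nk3] := boolP ((#|nb u| == 4) && (#|W u| == 3)).
  have [x xW] : exists x, x \in W u by apply/card_gt0P; rewrite k3.
  have /cards2P[y [z [yz Wx]]] : #|W u :\ x| == 2.
    by have := cardsD1 x (W u); rewrite xW k3 => /eqP; rewrite add1n eqSS eq_sym.
  have Wu : W u = x |: [set y; z] by rewrite -Wx finset.setD1K.
  have /andP[yx zx] : (y != x) && (z != x).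
    have: (y \in W u :\ x) && (z \in W u :\ x) by rewrite Wx !inE !eqxx orbT.
    by rewrite !finset.in_setD1 => /andP[/andP[-> _] /andP[-> _]].
  have [xu yu zu] : [/\ x != u, y != u & z != u].
    by split; apply: Wneq; rewrite Wu !inE eqxx ?orbT.
  have sum3 (F : I -> nat) : \sum_(w in x |: [set y; z]) F w = F x + F y + F z.
    by rewrite !big_setU1 ?inE ?negb_or 1?eq_sym ?yx 1?eq_sym //= big_set1 addnA.
  move: split S1; rewrite Wu !sum3 !adjI (adjC y x) (adjC z x) (adjC z y) d4 -cW k3 d4.
  rewrite -Wu k3 -!/(codeg u _).
  have D := adj_disjoint u; rewrite d4 in D.
  case xy: (adj x y); case yz1: (adj y z); case xz: (adj x z) => /=.
  - by case: (tri xy yz1); rewrite adjC.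
  - have := @path_others_lt u x y z; rewrite ![u == _]eq_sym xu zu ![x == _]eq_sym zx => /(_ isT isT isT d4 xy yz1).
    by clear; lia.
  - have := @path_others_lt u z x y; rewrite ![u == _]eq_sym yu zu => /(_ isT isT).
    by rewrite eq_sym yz adjC xz xy => /(_ isT d4 isT isT); clear; lia.
  - have := D _ _ xy; have := ale z; rewrite Wu !inE eqxx !orbT -/(codeg u z) => /(_ isT).
    by clear; lia.
  - have := @path_others_lt u y z x; rewrite ![u == _]eq_sym yu xu => /(_ isT isT).
    by rewrite yx yz1 adjC xz => /(_ isT d4 isT isT); clear; lia.
  - have := D _ _ yz1; have := ale x; rewrite Wu !inE eqxx -/(codeg u x) => /(_ isT).
    by clear; lia.
  - have := D _ _ xz; have := ale y; rewrite Wu !inE eqxx orbT -/(codeg u y) => /(_ isT).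
    by clear; lia.
  - have := @nonadjacent_others_lt u x y z d4 Wu; rewrite ![x == _]eq_sym yx zx.
    by move=> /(_ isT yz isT xy yz1 xz); clear; lia.
move: cI; rewrite !inE.
have h k : #|W u| = k -> \sum_w #|nb w| <= #|nb u|.*2 + (k * 3).*2 + k * k.-1.
  by move=> <-; rewrite split !leq_add // leq_double.
move: nk2 nk3 (h 0) (h 1) (h 2) sumle; rewrite -cW; clear.
move: #|nb u| #|W u| (\sum_w _) => p q S nk2 nk3 h0 h1 h2 Sle eI.
by case/or4P: eI Sle => /eqP e; rewrite e => Sle; lia.
Qed.
End Graph.

(** * From intersecting lines to graphs *)

Section Lines.
Variables (r : nat) (L V : finType) (v : L -> 'I_r -> V).

(** The tag [i] keeps the [r] vertices of a line distinct and lets lines meet only at equal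
    heights. *)
Definition edge (l : L) : {set 'I_r * V} := [set (i, v l i) | i : 'I_r].

Definition linear_lines := forall l1 l2 i j, i != j -> v l1 i = v l2 i -> v l1 j = v l2 j -> l1 = l2.

Definition no_triangle := forall l1 l2 l3 p1 p2 p3, uniq [:: p1; p2; p3] ->
  v l1 p1 = v l2 p1 -> v l2 p2 = v l3 p2 -> v l3 p3 = v l1 p3 -> l1 = l2.

Definition no_rainbow_quad := forall l1 l2 l3 l4 p1 p2 p3 p4, uniq [:: p1; p2; p3; p4] ->
  v l1 p1 = v l2 p1 -> v l2 p2 = v l3 p2 -> v l3 p3 = v l4 p3 -> v l4 p4 = v l1 p4 -> l1 = l2.

Hypotheses (lin : linear_lines) (tri : no_triangle) (quad : no_rainbow_quad).

(** A line through the vertex of [l] at height [i] that depends on this vertex only; the default is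
    never reached, as [l] itself qualifies. *)
Let rep i l := odflt l [pick l' | v l' i == v l i].

Let repP i l : v (rep i l) i = v l i.
Proof. by rewrite /rep; case: pickP => //= l' /eqP. Qed.

Let rep_eq i l l' : v l i = v l' i -> rep i l = rep i l'.
Proof.
rewrite /rep => e; rewrite (eq_pick (fun z => congr1 (eq_op (v z i)) e)).
by case: pickP => //= /(_ l'); rewrite eqxx.
Qed.

(* The lines through a point form a star around the representative, not a
   clique: the edges of this graph then count the incidences lost in the union,
   and a triangle of edges cannot arise from three concurrent lines. *)
Let adj l l' := (l != l') && [exists i, (v l i == v l' i) && ((rep i l == l) || (rep i l == l'))].

Let c l l' := [pick i | v l i == v l' i].

Let cE l l' i : l != l' -> v l i = v l' i -> c l l' = Some i.
Proof.
move=> ll e; rewrite /c; case: pickP => [j /eqP ej|/(_ i)]; last by rewrite e eqxx.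
by congr Some; apply: contraNeq ll => ji; apply/eqP; apply: lin ej e.
Qed.

Let adjC : symmetric adj.
Proof.
move=> l l'; rewrite /adj eq_sym; congr (_ && _); apply: eq_existsb => i.
rewrite [v l' i == _]eq_sym; case: eqP => //= e.
by rewrite (rep_eq e) orbC.
Qed.

Let cC l l' : c l l' = c l' l.
Proof. by apply: eq_pick => i; rewrite eq_sym. Qed.

Let adjP l l' : adj l l' -> exists i, [/\ l != l', c l l' = Some i, v l i = v l' i &
  (rep i l = l \/ rep i l = l')].
Proof.
case/andP => ll /existsP[i /andP[/eqP e R]]; exists i; split=> //; first exact: cE.
by case/orP: R => /eqP; [left|right].
Qed.

(** Three distinct pairwise meeting lines are concurrent: two equal heights give a common point, and
    three distinct heights form a forbidden triangle. *)
Let meet3 j k l i1 i2 i3 : j != k -> k != l -> l != j ->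
  v j i1 = v k i1 -> v k i2 = v l i2 -> v l i3 = v j i3 -> i1 = i2 /\ i2 = i3.
Proof.
move=> jk kl lj e1 e2 e3.
have [e12|n12] := eqVneq i1 i2.
  subst i2; split=> //; apply: contraNeq lj => n; apply/eqP.
  by apply: (lin n _ e3); rewrite -e2 -e1.
have [e23|n23] := eqVneq i2 i3.
  subst i3; split=> //; apply: contraNeq jk => n; apply/eqP.
  by apply: (lin n e1); rewrite e2 e3.
have [e13|n13] := eqVneq i1 i3.
  subst i3; exfalso; move/negP: kl; apply; apply/eqP; apply: (lin n12 _ e2).
  by rewrite -e1 e3.
by case/eqP: jk; apply: (tri _ e1 e2 e3); rewrite /= !inE negb_or n12 n13 n23.
Qed.

(** The three lines would be concurrent, and a star contains no triangle. *)
Let adj_tri j k l : adj j k -> adj k l -> adj l j -> False.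
Proof.
move=> /adjP[i1 [jk _ e1 R1]] /adjP[i2 [kl _ e2 R2]] /adjP[i3 [lj _ e3 R3]].
have [? ?] := meet3 jk kl lj e1 e2 e3; subst i2 i3.
move: R1 R2 R3; rewrite (rep_eq e1) (rep_eq e2).
by move: jk kl lj => /eqP + /eqP + /eqP +; intuition congruence.
Qed.

(** Equal consecutive labels make all four lines concurrent, but the edges [j k] and [l m] of one
    star cannot be disjoint. *)
Let adj_quad_neq j k l m : j != l -> k != m ->
  adj j k -> adj k l -> adj l m -> adj m j -> c j k <> c k l.
Proof.
move=> jl km /adjP[i1 [jk -> e1 R1]] /adjP[i2 [kl -> e2 R2]].
move=> /adjP[i3 [lm _ e3 R3]] /adjP[i4 [mj _ e4 R4]] [?]; subst i2.
have e5 : v j i1 = v l i1 by rewrite e1.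
have [? ?] := meet3 jl lm mj e5 e3 e4; subst i3 i4.
move: R1 R3; rewrite (rep_eq e5).
by move: jk km kl lm jl mj => /eqP + /eqP + /eqP + /eqP + /eqP + /eqP; intuition congruence.
Qed.

Let adj_quad_opp j k l m : j != l -> k != m ->
  adj j k -> adj k l -> adj l m -> adj m j -> c j k = c l m \/ c k l = c m j.
Proof.
move=> jl km jk kl lm mj.
have n1 := adj_quad_neq jl km jk kl lm mj.
have n2 : c k l <> c l m by apply: (adj_quad_neq (m := j)); rewrite // eq_sym.
have n3 : c l m <> c m j by apply: (adj_quad_neq (m := k)) => //; rewrite eq_sym.
have n4 : c m j <> c j k by apply: (adj_quad_neq (m := l)); rewrite // eq_sym.
have [i1 [jk' c1 e1 _]] := adjP jk; have [i2 [_ c2 e2 _]] := adjP kl.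
have [i3 [_ c3 e3 _]] := adjP lm; have [i4 [_ c4 e4 _]] := adjP mj.
move: n1 n2 n3 n4; rewrite c1 c2 c3 c4 => n1 n2 n3 n4.
have [->|n13] := eqVneq i1 i3; first by left.
have [->|n24] := eqVneq i2 i4; first by right.
case/eqP: jk'; apply: (quad _ e1 e2 e3 e4); rewrite /= !inE !negb_or n13 n24 /= !andbT.
by rewrite -andbA; apply/and4P; split; apply/eqP => ?; subst; auto.
Qed.

Let P := [set p : 'I_r * L | rep p.1 p.2 != p.2].

(** An incidence in [P] gives the edge from its line to the representative; [f] and [g] are the two
    orientations. Linearity makes these edges distinct for distinct incidences. *)
Let card_collisions : #|P|.*2 <= \sum_l #|[set l' | adj l l']|.
Proof.
pose f (p : 'I_r * L) := (rep p.1 p.2, p.2).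
pose g (p : 'I_r * L) := (p.2, rep p.1 p.2).
have fg p q : p \in P -> (f p = f q \/ g p = g q) -> p = q.
  case: p q => [i l] [i' l'] /=; rewrite inE /f /g /= => R e.
  have [Re El] : rep i l = rep i' l' /\ l = l' by case: e => -[].
  subst l'.
  have [<- //|n] := eqVneq i i'; case/eqP: R; apply: (lin n); first exact: repP.
  by rewrite Re repP.
have injf : {in P &, injective f} by move=> p q pP _ e; apply: fg => //; left.
have injg : {in P &, injective g} by move=> p q pP _ e; apply: fg => //; right.
have Pv p : p \in P -> v p.2 p.1 = v (rep p.1 p.2) p.1 by rewrite repP.
have dis : [disjoint f @: P & g @: P].
  apply/pred0Pn => -[_ /= /andP[/imsetP[[i l] pP ->] /imsetP[[i' l'] qP]]].
  have := Pv _ pP; have := Pv _ qP; move: pP qP; rewrite !inE /f /g /= => R R' e' e [E1 E2].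
  have ii : i = i'.
    apply: contraNeq R => n; rewrite E1; apply/eqP; apply: (lin n).
      by rewrite -E1 -e.
    by rewrite e' E2.
  by subst i'; case/eqP: R; rewrite {2}E2; apply: rep_eq; rewrite e E1.
rewrite -addnn -{1}(card_in_imset injf) -(card_in_imset injg).
have := (leq_card_setU (f @: P) (g @: P)).2; rewrite dis => /eqP <-.
apply: leq_trans (_ : #|[set q : L * L | adj q.1 q.2]| <= _).
  apply: subset_leq_card; apply/fintype.subsetP => q; rewrite !inE.
  have adjR p : p \in P -> adj (rep p.1 p.2) p.2.
    rewrite inE => R; rewrite /adj R; apply/existsP; exists p.1; rewrite repP eqxx /=.
    by apply/orP; left; rewrite (rep_eq (repP _ _)).
  by case/orP => /imsetP[p pP ->] /=; rewrite ?adjR // adjC adjR.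
rewrite -sum1_card (eq_bigl (fun q : L * L => true && adj q.1 q.2)); last by move=> q; rewrite inE.
rewrite -(pair_big_dep predT adj (fun _ _ => 1)) /=.
by apply: leq_sum => l _; rewrite -sum1_card; under [X in _ <= X]eq_bigl do rewrite inE.
Qed.

Lemma card_cover_edges : 2 <= r -> #|L| \in [:: 4; 5; 7; 8] ->
  #|L| * (r - 2) + 4 <= #|\bigcup_l edge l|.
Proof.
move=> r2 cL.
have lt := sum_deg_lt adjC cC adj_tri adj_quad_neq adj_quad_opp cL.
have le := leq_ltn_trans card_collisions lt.
have total : #|P| + #|~: P| = r * #|L| by rewrite cardsC card_prod card_ord.
(* Incidences outside [P] belong to representatives, so each is determined by its vertex. *)
have sub : #|~: P| <= #|\bigcup_l edge l|.
  have inj : {in ~: P &, injective (fun p : 'I_r * L => (p.1, v p.2 p.1))}.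
    move=> [i l] [i' l']; rewrite !inE !negbK /= => /eqP R /eqP R' [? e]; subst i'.
    by rewrite -R -R' (rep_eq e).
  rewrite -(card_in_imset inj); apply: subset_leq_card; apply/fintype.subsetP => _ /imsetP[[i l] _ ->].
  by apply/bigcupP; exists l => //; apply/imsetP; exists i.
(* From [2 * #|P| < 4 * #|L| - 6]; integrality gains the last unit. *)
have : #|P| <= 2 * #|L| - 4 by move: cL le; rewrite !inE; clear; lia.
move: cL total sub r2; rewrite !inE; clear.
move: #|L| #|P| #|~: P| #|_| => e p q t.
by case/or4P => /eqP ->; lia.
Qed.

End Lines.

(** * From line systems to the extremal function *)

Lemma leq_turan (V : finType) (r v e n : nat) (H : hypergraph V) :
  uniform r H -> Gfree v e H -> #|V| <= n -> #|H| <= turan r n v e.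
Proof.
move=> uH gH Vn.
pose f x := widen_ord Vn (enum_rank x).
have injf : injective f by move=> x y /(congr1 val) /= /val_inj/enum_rank_inj.
have injF : injective (fun A : {set V} => f @: A) by apply: imset_inj.
pose H' : {set {set 'I_n}} := [set f @: (A : {set V}) | A in H].
rewrite -(card_imset _ injF) -/H'; apply: (@leq_bigmax_cond _ _ _ H').
apply/andP; split.
  apply/forall_inP => _ /imsetP[A AH ->]; rewrite card_imset //.
  by move/forall_inP: uH; apply.
apply/forallP => S; apply/implyP => /andP[SH Se].
pose S0 := [set A : {set V} in H | f @: A \in S].
have SE : S = [set f @: (A : {set V}) | A in S0].
  apply/setP => B; apply/idP/imsetP => [BS|[A]]; last by rewrite inE => /andP[_ AS] ->.
  have /imsetP[A AH BE] := fintype.subsetP SH _ BS.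
  by exists A => //; rewrite inE AH -BE.
have := forallP gH S0; rewrite -[#|S0|](card_imset _ injF) -SE Se andbT.
have -> : S0 \subset H by apply/fintype.subsetP => A; rewrite inE => /andP[].
move=> /leq_trans; apply.
rewrite -(card_imset _ injf); apply: subset_leq_card.
apply/fintype.subsetP => _ /imsetP[x /bigcupP[A AS xA] ->].
apply/bigcupP; exists (f @: A); last exact: imset_f.
by move: AS; rewrite inE => /andP[].
Qed.

Lemma turan_lines (r e n : nat) (L V : finType) (v : L -> 'I_r -> V) :
  2 <= r -> e \in [:: 4; 5; 7; 8] -> r * #|V| <= n ->
  linear_lines v -> no_triangle v -> no_rainbow_quad v -> #|L| <= turan r n (e * (r - 2) + 3) e.
Proof.
move=> r2 he Vn lin tri quad.
have mem_edge l p : (p \in edge v l) = (p.2 == v l p.1).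
  apply/imsetP/eqP => [[i _ ->] //|E]; exists p.1 => //; by rewrite -E; case: p {E}.
have injE : injective (edge v).
  move=> l l' /setP E; pose i := Ordinal (ltnW r2); pose j := Ordinal r2.
  apply: (lin _ _ i j) => //.
    by have := E (i, v l i); rewrite !mem_edge eqxx => /esym/eqP.
  by have := E (j, v l j); rewrite !mem_edge eqxx => /esym/eqP.
rewrite -cardsT -(card_imset _ injE).
apply: (@leq_turan ('I_r * V)%type); last by rewrite card_prod card_ord.
  apply/forall_inP => _ /imsetP[l _ ->]; rewrite card_imset ?card_ord //.
  by move=> i j [].
apply/forallP => S; apply/implyP => /andP[SH /eqP Se].
pose A := [set l | edge v l \in S].
have SE : S = edge v @: A.
  apply/setP => B; apply/idP/imsetP => [BS|[l]]; last by rewrite inE => lS ->.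
  have /imsetP[l _ BE] := fintype.subsetP SH _ BS.
  by exists l; rewrite // inE -BE.
have cA : #|A| = e by rewrite -Se SE card_imset.
pose w (l : {l | l \in A}) := v (val l).
have := @card_cover_edges r {l | l \in A} V w; rewrite card_sig.
have -> : #|[pred x | x \in A]| = e by rewrite -cA; apply: eq_card.
rewrite addn1 addnS => h; apply: leq_trans (h _ _ _ r2 he) _.
- by move=> l1 l2 i j ij e1 e2; apply: val_inj; apply: (lin _ _ _ _ ij).
- by move=> l1 l2 l3 i j k u e1 e2 e3; apply: val_inj; apply: (tri _ _ _ _ _ _ u e1 e2 e3).
- by move=> l1 l2 l3 l4 i j k m u e1 e2 e3 e4; apply: val_inj; apply: (quad _ _ _ _ _ _ _ _ u e1 e2 e3 e4).
apply: subset_leq_card; apply/fintype.subsetP => x /bigcupP[l _ xl].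
apply/bigcupP; exists (edge v (val l)) => //.
by have := valP l; rewrite inE.
Qed.

(** * Lines with directions on a sphere *)

(** Uniqueness of base [T] digits: at the lowest differing position, cancel the lower terms, divide
    by [T ^ w i] and reduce modulo [T]. It serves both the exponents (base [D]) and the coefficients
    (base [b.+1]). *)
Lemma digits_inj (I : finType) (T : nat) (w f g : I -> nat) :
  injective w -> (forall i, f i < T) -> (forall i, g i < T) ->
  \sum_i f i * T ^ w i = \sum_i g i * T ^ w i -> f =1 g.
Proof.
move=> injw fT gT E i0; apply/eqP; apply: contraT => ne0.
case: (arg_minnP w (P := fun i => f i != g i) ne0) => i ne min_i.
have T0 : 0 < T by apply: leq_ltn_trans (fT i).
have split (h : I -> nat) : exists q, \sum_j h j * T ^ w j =
    \sum_(j | w j < w i) h j * T ^ w j + (h i + T * q) * T ^ w i.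
  exists (\sum_(j | ~~ (w j < w i) && (j != i)) h j * T ^ (w j - (w i).+1)).
  rewrite (bigID (fun j => w j < w i)) /=; congr (_ + _).
  rewrite (bigD1 i) ?ltnn //= mulnDl; congr (_ + _).
  rewrite mulnAC -expnS mulnC big_distrl; apply: eq_bigr => j /andP[].
  rewrite -leqNgt => le ne_ij; rewrite /= -mulnA -expnD subnK //.
  by rewrite ltn_neqAle le andbT (inj_eq injw) eq_sym.
have [q Ef] := split f; have [q' Eg] := split g.
move: E; rewrite Ef Eg (eq_bigr (fun j => g j * T ^ w j)); last first.
  move=> j jlt; have [-> //|/min_i] := eqVneq (f j) (g j).
  by rewrite leqNgt jlt.
move/addnI/eqP; rewrite eqn_pmul2r ?expn_gt0 ?T0 // => /eqP /(congr1 (modn^~ T)).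
by rewrite ![T * _]mulnC !(addnC _ (_ * T)) !modnMDl !modn_small // => /eqP; rewrite (negPf ne).
Qed.

Lemma popular_fiber (Y Z : finType) (F : Y -> Z) :
  0 < #|Z| -> exists z, #|Y| <= #|Z| * #|[set y | F y == z]|.
Proof.
case/card_gt0P => z0 _; have [z _ zmax] := arg_maxnP (fun z => #|[set y | F y == z]|) (erefl true : predT z0).
exists z; rewrite -sum_nat_const -[#|Y|]sum1_card (partition_big F xpredT) //=.
apply: leq_sum => z1 _; apply: leq_trans (zmax z1 isT).
by rewrite -sum1_card; under [X in _ <= X]eq_bigl do rewrite inE.
Qed.

Section Sphere.
Import Order.TTheory GRing.Theory Num.Theory.
Local Open Scope ring_scope.

(** The weighted sum of the squared distances from [m1] to [m2], [m3], [m4] expands to 0 because all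
    norms agree, so the term with the positive weight [w2] vanishes. *)
Lemma sphere_strictly_convex (I : finType) (m1 m2 m3 m4 : I -> int) (w2 w3 w4 rho : int) :
  0 < w2 -> 0 <= w3 -> 0 <= w4 ->
  (forall c, (w2 + w3 + w4) * m1 c = w2 * m2 c + w3 * m3 c + w4 * m4 c) ->
  \sum_c m1 c ^+ 2 = rho -> \sum_c m2 c ^+ 2 = rho -> \sum_c m3 c ^+ 2 = rho ->
  \sum_c m4 c ^+ 2 = rho -> m1 =1 m2.
Proof.
move=> w2_gt0 w3_ge0 w4_ge0 comb s1 s2 s3 s4.
pose t c := w2 * (m2 c - m1 c) ^+ 2 + w3 * (m3 c - m1 c) ^+ 2 + w4 * (m4 c - m1 c) ^+ 2.
have t_ge0 c : true -> 0 <= t c.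
  by move=> _; rewrite !addr_ge0 // mulr_ge0 ?sqr_ge0 // ltW.
have sum_t : \sum_c t c = 0.
  have tE c : t c = w2 * m2 c ^+ 2 + w3 * m3 c ^+ 2 + w4 * m4 c ^+ 2 - (w2 + w3 + w4) * m1 c ^+ 2.
    have -> : (w2 + w3 + w4) * m1 c ^+ 2 =
      2 * m1 c * ((w2 + w3 + w4) * m1 c) - (w2 + w3 + w4) * m1 c ^+ 2 by ring.
    by rewrite comb /t; ring.
  rewrite (eq_bigr _ (fun c _ => tE c)) sumrB !big_split /= -!mulr_sumr s1 s2 s3 s4.
  by ring.
move=> c; have /eqP := sum_t; rewrite psumr_eq0 // => /allP/(_ c).
rewrite mem_index_enum => /(_ isT) /=.
rewrite paddr_eq0; last 2 first.
- by rewrite addr_ge0 // mulr_ge0 ?sqr_ge0 // ltW.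
- by rewrite mulr_ge0 ?sqr_ge0.
rewrite paddr_eq0; last 2 first.
- by rewrite mulr_ge0 ?sqr_ge0 // ltW.
- by rewrite mulr_ge0 ?sqr_ge0.
by rewrite mulf_eq0 (gt_eqF w2_gt0) sqrf_eq0 subr_eq0 => /andP[/andP[/eqP -> _] _].
Qed.

(** Eliminating the [x]'s gives the convex combination, with the gaps between heights as weights.
    The weak inequalities admit quadrilaterals with repeated heights. *)
Lemma quad_sphere (I : finType) (x1 x2 x3 x4 m1 m2 m3 m4 : I -> nat) (t1 t2 t3 t4 rho : nat) :
  (t1 < t2)%N -> (t2 <= t3)%N -> (t3 <= t4)%N ->
  (forall c, x1 c + t1 * m1 c = x2 c + t1 * m2 c)%N ->
  (forall c, x2 c + t2 * m2 c = x3 c + t2 * m3 c)%N ->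
  (forall c, x3 c + t3 * m3 c = x4 c + t3 * m4 c)%N ->
  (forall c, x4 c + t4 * m4 c = x1 c + t4 * m1 c)%N ->
  (\sum_c m1 c ^ 2 = rho)%N -> (\sum_c m2 c ^ 2 = rho)%N -> (\sum_c m3 c ^ 2 = rho)%N ->
  (\sum_c m4 c ^ 2 = rho)%N -> m1 =1 m2.
Proof.
move=> t12 t23 t34 e1 e2 e3 e4 s1 s2 s3 s4.
have castS (m : I -> nat) : (\sum_c m c ^ 2 = rho)%N -> \sum_c (m c)%:Z ^+ 2 = rho%:Z.
  move=> <-; rewrite (big_morph Posz PoszD (erefl _)).
  by apply: eq_bigr => c _; rewrite expr2 -PoszM.
have := @sphere_strictly_convex I (fun c => (m1 c)%:Z) (fun c => (m2 c)%:Z) (fun c => (m3 c)%:Z)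
  (fun c => (m4 c)%:Z) (t2%:Z - t1%:Z) (t3%:Z - t2%:Z) (t4%:Z - t3%:Z) rho%:Z.
move=> h c; have /(_ c)[] // : (fun c => (m1 c)%:Z) =1 (fun c => (m2 c)%:Z).
apply: h; [lia|lia|lia| |exact: castS..] => {}c.
by have := e1 c; have := e2 c; have := e3 c; have := e4 c; clear; nia.
Qed.
End Sphere.

(** * Polynomial lines over a popular fiber *)

Section Construction.
Variables (r D d b : nat).
Hypotheses (D_gt1 : 1 < D) (b_gt0 : 0 < b).

(* An [x : points N] stands for a [d]-tuple of polynomials in [r] variables, of
   degree less than [N] in each of them and with coefficients at most [b];
   [shift i] is the multiplication by the [i]-th variable, and [eval s] is the
   Kronecker substitution of [height s i] for that variable: it is injective for
   [N = D] as soon as [s] is, and it orders the variables as [s] does. *)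
Definition monom N := {ffun 'I_r -> 'I_N}.

(** There are [r.+4] ranks because a rank will be an index in a list of four chosen variables
    followed by all [r] of them. *)
Definition ranking := {ffun 'I_r -> 'I_r.+4}.

Definition weight (s : ranking) N (k : monom N) := \sum_i k i * D ^ s i.

Definition eval (s : ranking) N (x : monom N * 'I_d -> nat) c :=
  \sum_k x (k, c) * b.+1 ^ weight s k.

Definition height (s : ranking) i := b.+1 ^ (D ^ s i).

Definition incr i (k : monom D) : monom D.+1 := [ffun j => inord (k j + (j == i))].

Definition shift i (m : monom D * 'I_d -> nat) (p : monom D.+1 * 'I_d) :=
  \sum_(k | incr i k == p.1) m (k, p.2).

Lemma incrE i k j : incr i k j = k j + (j == i) :> nat.
Proof.
rewrite ffunE inordK // ltnS; have := ltn_ord (k j).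
by case: (j == i); rewrite ?addn1 ?addn0 // => /ltnW.
Qed.

Lemma incr_inj i : injective (incr i).
Proof.
move=> k k' E; apply/ffunP => j; apply: val_inj; apply/eqP.
by have := incrE i k j; rewrite E incrE => /eqP; rewrite eqn_add2r eq_sym.
Qed.

Lemma weight_incr s i k : weight s (incr i k) = weight s k + D ^ s i.
Proof.
rewrite /weight (eq_bigr (fun j => k j * D ^ s j + (j == i) * D ^ s j)); last first.
  by move=> j _; rewrite incrE mulnDl.
rewrite big_split; congr (_ + _); rewrite (bigD1 i) //= eqxx mul1n big1 ?addn0 //.
by move=> j /negPf->.
Qed.

Lemma eval_shift s i m c : eval s (shift i m) c = height s i * eval s m c.
Proof.
rewrite /eval big_distrr [RHS](partition_big (incr i) xpredT) //=.
apply: eq_bigr => k _; rewrite /shift big_distrl; apply: eq_bigr => k' /= /eqP <-.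
by rewrite weight_incr expnD mulnA mulnC.
Qed.

Lemma shift_le i m p : (forall q, m q <= b) -> shift i m p <= b.
Proof.
move=> mb; rewrite /shift; case: (pickP (fun k => incr i k == p.1)) => [k /eqP kp|none].
  by rewrite (big_pred1 k) // => k'; rewrite -kp /= (inj_eq (@incr_inj i)).
by rewrite big_pred0.
Qed.

Lemma weight_inj (s : ranking) : injective s -> injective (@weight s D).
Proof.
move=> injs k k' E; apply/ffunP => j; apply: val_inj.
have injw : injective (fun i => s i : nat) by move=> i i' /val_inj/injs.
exact: (@digits_inj 'I_r D _ (fun j => k j) (fun j => k' j) injw _ _ E j).
Qed.

Definition points N := {ffun monom N * 'I_d -> 'I_b.+1}.

Lemma eval_inj (s : ranking) (m m' : points D) : injective s ->
  eval s (fun p => m p) =1 eval s (fun p => m' p) -> m = m'.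
Proof.
move=> injs E; apply/ffunP => -[k c]; apply: val_inj.
exact: (@digits_inj _ b.+1 _ (fun k => m (k, c)) (fun k => m' (k, c)) (weight_inj injs) _ _ (E c) k).
Qed.

Lemma height_lt (s : ranking) i j : s i < s j -> height s i < height s j.
Proof. by move=> lt; rewrite /height ltn_exp2l // ltn_exp2l. Qed.

Lemma height_le (s : ranking) i j : s i <= s j -> height s i <= height s j.
Proof. by move=> le; rewrite /height leq_exp2l // leq_exp2l. Qed.

Definition sqnorm (s : ranking) (m : points D) := \sum_c eval s (fun p => m p) c ^ 2.

(** A crude bound; what matters is that the exponent of [b.+1] is free of [d]. *)
Definition sqnorm_bound := d * (D ^ r * b.+1 ^ (r * D ^ r.+4).+1) ^ 2.

Lemma weight_le s (k : monom D) : weight s k <= r * D ^ r.+4.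
Proof.
rewrite /weight -[X in X * _]card_ord -sum_nat_const; apply: leq_sum => i _.
rewrite expnS; apply: leq_mul; first exact/ltnW/ltn_ord.
by rewrite leq_exp2l // -ltnS.
Qed.

Lemma eval_le s (m : points D) c :
  eval s (fun p => m p) c <= D ^ r * b.+1 ^ (r * D ^ r.+4).+1.
Proof.
have -> : D ^ r = #|monom D| by rewrite card_ffun !card_ord.
rewrite -sum_nat_const; apply: leq_sum => k _; have := weight_le s k.
move: (r * _) (weight s k) => W w le_wW.
by rewrite expnS; apply: leq_mul; [exact/ltnW/ltn_ord | rewrite leq_pexp2l].
Qed.

Lemma sqnorm_le s m : sqnorm s m <= sqnorm_bound.
Proof.
rewrite /sqnorm /sqnorm_bound -[X in X * _]card_ord -sum_nat_const.
apply: leq_sum => c _; have := eval_le s m c.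
by move: (eval _ _ _) (D ^ r * _) => x y le_xy; rewrite leq_exp2r.
Qed.

Definition spheres := {ffun ranking -> 'I_sqnorm_bound.+1}.

Definition radii (m : points D) : spheres := [ffun s => inord (sqnorm s m)].

Variable z : spheres.

Definition line := (points D.+1 * {m : points D | radii m == z})%type.

(** A coefficient of the position and one of the shifted direction add up to at most [b.*2], so
    [inord] does not truncate. *)
Definition vertex (l : line) i : {ffun monom D.+1 * 'I_d -> 'I_(b.*2).+1} :=
  [ffun p => inord (l.1 p + shift i (fun q => val l.2 q) p)].

Lemma vertexE l i p : vertex l i p = l.1 p + shift i (fun q => val l.2 q) p :> nat.
Proof.
rewrite ffunE inordK // ltnS -addnn; apply: leq_add; first by rewrite -ltnS.
by apply: shift_le => q; rewrite -ltnS.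
Qed.

Let pos s (l : line) c := eval s (fun p => l.1 p) c.
Let dir s (l : line) c := eval s (fun p => val l.2 p) c.

Lemma eval_vertex s l i c : eval s (fun p => vertex l i p) c = pos s l c + height s i * dir s l c.
Proof.
rewrite -eval_shift -big_split /=; apply: eq_bigr => k _.
by rewrite vertexE mulnDl.
Qed.

Lemma meet_eval s l l' i : vertex l i = vertex l' i ->
  forall c, pos s l c + height s i * dir s l c = pos s l' c + height s i * dir s l' c.
Proof. by move=> E c; rewrite -!eval_vertex E. Qed.

Lemma sum_dir s l : \sum_c dir s l c ^ 2 = z s.
Proof.
have /eqP/ffunP/(_ s) <- := valP l.2.
by rewrite ffunE inordK // ltnS sqnorm_le.
Qed.

(** Under the substitution [s] the heights are ordered, so convexity equates the evaluated
    directions and injectivity of [eval] the directions; the common vertex at [p1] then equates the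
    positions. *)
Lemma closed_quad (s : ranking) l1 l2 l3 l4 p1 p2 p3 p4 : injective s ->
  s p1 < s p2 -> s p2 <= s p3 -> s p3 <= s p4 ->
  vertex l1 p1 = vertex l2 p1 -> vertex l2 p2 = vertex l3 p2 ->
  vertex l3 p3 = vertex l4 p3 -> vertex l4 p4 = vertex l1 p4 -> l1 = l2.
Proof.
move=> injs lt12 le23 le34 e1 e2 e3 e4.
have Em : val l1.2 = val l2.2.
  apply: (eval_inj injs); apply: (quad_sphere (height_lt lt12) (height_le le23) (height_le le34)
    (meet_eval s e1) (meet_eval s e2) (meet_eval s e3) (meet_eval s e4)); exact: sum_dir.
have Ex : l1.1 = l2.1.
  apply/ffunP => p; apply: val_inj; apply/eqP.
  have := vertexE l1 p1 p; rewrite e1 vertexE Em => /eqP.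
  by rewrite eqn_add2r eq_sym.
by case: l1 l2 Em Ex {e1 e2 e3 e4} => [x1 m1] [x2 m2] /= /val_inj-> ->.
Qed.

(* Equal arguments get equal ranks, so that triangles and pairs of common points
   are degenerate instances of [closed_quad]. *)
Definition rank4 p1 p2 p3 p4 : ranking :=
  [ffun p => inord (index p ([:: p1; p2; p3; p4] ++ enum 'I_r))].

Lemma rank4E p1 p2 p3 p4 p : rank4 p1 p2 p3 p4 p = index p ([:: p1; p2; p3; p4] ++ enum 'I_r) :> nat.
Proof.
rewrite ffunE inordK // -[X in _ < X]/(4 + r) -[X in 4 + X](size_enum_ord r) -(size_cat [:: p1; p2; p3; p4]).
by rewrite index_mem mem_cat mem_enum orbT.
Qed.

Lemma rank4_inj p1 p2 p3 p4 : injective (rank4 p1 p2 p3 p4).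
Proof.
move=> p q /(congr1 val); rewrite /= !rank4E.
by apply: (index_inj p); rewrite ?mem_cat ?mem_enum ?orbT.
Qed.

Lemma vertex_linear : linear_lines vertex.
Proof.
move=> l1 l2 i j ij e1 e2.
apply: (@closed_quad (rank4 i j j j) l1 l2 l2 l1 i j j j) => //; rewrite ?rank4E /=; first exact: rank4_inj.
by rewrite !eqxx (negPf ij).
Qed.

Lemma vertex_no_triangle : no_triangle vertex.
Proof.
move=> l1 l2 l3 p1 p2 p3 + e1 e2 e3; rewrite /= !inE negb_or andbT => /andP[/andP[n12 n13] n23].
apply: (@closed_quad (rank4 p1 p2 p3 p3) l1 l2 l3 l1 p1 p2 p3 p3) => //; rewrite ?rank4E /=; first exact: rank4_inj.
  by rewrite !eqxx (negPf n12).
by rewrite !eqxx (negPf n12) (negPf n13) (negPf n23).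
Qed.

Lemma vertex_no_rainbow_quad : no_rainbow_quad vertex.
Proof.
move=> l1 l2 l3 l4 p1 p2 p3 p4 + e1 e2 e3 e4; rewrite /= !inE !negb_or andbT.
move=> /and3P[/and3P[n12 n13 n14] /andP[n23 n24] n34].
apply: (@closed_quad (rank4 p1 p2 p3 p4) l1 l2 l3 l4 p1 p2 p3 p4) => //; rewrite ?rank4E /=; first exact: rank4_inj.
- by rewrite !eqxx (negPf n12).
- by rewrite !eqxx (negPf n12) (negPf n13) (negPf n23).
- by rewrite !eqxx (negPf n13) (negPf n23) (negPf n14) (negPf n24) (negPf n34).
Qed.

End Construction.

(** Positions are free and directions fill a popular fiber of [radii], which takes at most
    [(sqnorm_bound r D d b).+1 ^ (r.+4 ^ r)] values, one radius for each ranking. *)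
Lemma turan_lower_bound r e D d b n : 3 <= r -> e \in [:: 4; 5; 7; 8] -> 1 < D -> 0 < b ->
  r * b.*2.+1 ^ (d * D.+1 ^ r) <= n ->
  b.+1 ^ (d * D.+1 ^ r + d * D ^ r) <=
  turan r n (e * (r - 2) + 3) e * (sqnorm_bound r D d b).+1 ^ (r.+4 ^ r).
Proof.
move=> r3 he D1 b0 Vn.
have [|z zP] := @popular_fiber (points r d b D) _ (@radii r D d b).
  by apply/card_gt0P; exists [ffun=> ord0].
have := @turan_lines r e n _ _ (@vertex r D d b z) (ltnW r3) he.
rewrite !card_ffun card_prod card_ffun !card_ord [D.+1 ^ r * d]mulnC => /(_ Vn).
move=> /(_ (vertex_linear D1 b0 (z:=z)) (vertex_no_triangle D1 b0 (z:=z)) (vertex_no_rainbow_quad D1 b0 (z:=z))).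
rewrite card_prod card_sig !card_ffun card_prod card_ffun !card_ord [D.+1 ^ r * d]mulnC.
move: zP; rewrite !card_ffun card_prod !card_ffun !card_ord [D ^ r * d]mulnC cardsE expnD.
move: (turan _ _ _ _) (_ ^ _ ^ _) (_ ^ (d * D.+1 ^ r)) (_ ^ (d * D ^ r)) => t q x y.
move: #|_| => N yle xle; rewrite (leq_trans (leq_mul (leqnn x) yle)) //.
by rewrite mulnC -mulnA [N * x]mulnC [t * q]mulnC leq_mul.
Qed.

(** * Asymptotics *)

Import Order.TTheory GRing.Theory Num.Theory numFieldNormedType.Exports.
Local Open Scope classical_set_scope.
Local Open Scope ring_scope.


(** Take [b] maximal; [3 ^ G] is the case [b = 1], and failure at [b.+1] gives the upper bound since
    2b + 3 is at most 4(b + 1). *)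
Lemma largest_base r G n : (0 < r)%N -> (0 < G)%N -> (r * 3 ^ G <= n)%N ->
  exists b, [/\ (0 < b)%N, (r * b.*2.+1 ^ G <= n)%N & (n < r * (4 * b.+1) ^ G)%N].
Proof.
move=> r0 G0 n3.
have bound b : (r * b.*2.+1 ^ G <= n)%N -> (b <= n)%N.
  apply: leq_trans; apply: leq_trans (leq_pmull _ r0).
  apply: leq_trans (_ : b.*2.+1 ^ 1 <= _)%N; last by rewrite leq_pexp2l.
  by rewrite expn1 -addnn; lia.
have ex : exists b, (r * b.*2.+1 ^ G <= n)%N by exists 1%N.
case: (ex_maxnP ex bound) => b bn bmax; exists b; split=> //; first exact: bmax.
rewrite ltnNge; apply/negP => le; have := bmax b.+1; rewrite ltnn => F; apply: notF; apply: F.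
apply: leq_trans le; rewrite leq_mul2l leq_exp2r //; apply/orP; right.
by rewrite -addnn; lia.
Qed.

(** Bernoulli's inequality for the power [r] of D/(D + 1), cleared of denominators: for large [D],
    directions have almost as many coefficients as positions. *)
Lemma bernoulli_nat D r : (D.+1 ^ r * D.+1 <= D ^ r * D.+1 + r * D.+1 ^ r)%N.
Proof.
elim: r => [|r IH]; first by rewrite !expn0 mul0n addn0.
have le : (D ^ r <= D.+1 ^ r)%N by case: r {IH} => // r; rewrite leq_exp2r.
move: IH le; rewrite !expnS; move: (D ^ r)%N (D.+1 ^ r)%N => x y IH le; nia.
Qed.

Lemma turan_bound r e D d n : (3 <= r)%N -> e \in [:: 4; 5; 7; 8]%N -> (1 < D)%N -> (0 < d)%N ->
  (r * 3 ^ (d * D.+1 ^ r) <= n)%N ->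
  exists2 T, (0 < T)%N /\ (n < r * (4 * T) ^ (d * D.+1 ^ r))%N &
    (T ^ (d * D.+1 ^ r + d * D ^ r) <= turan r n (e * (r - 2) + 3) e *
     ((d * (D ^ r) ^ 2).+1 * T ^ (2 * (r * D ^ r.+4).+1)) ^ (r.+4 ^ r))%N.
Proof.
move=> r3 he D1 d0 n3.
have G0 : (0 < d * D.+1 ^ r)%N by rewrite muln_gt0 d0 expn_gt0.
have [b [b0 bn nb]] := largest_base (ltnW (ltnW r3)) G0 n3.
exists b.+1 => //; apply: leq_trans (turan_lower_bound r3 he D1 b0 bn) _.
rewrite leq_mul2l leq_exp2r ?expn_gt0 //; apply/orP; right.
rewrite /sqnorm_bound [(2 * _)%N]mulnC expnM.
have : (0 < b.+1 ^ (r * D ^ r.+4).+1)%N by rewrite expn_gt0.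
move: (D ^ r)%N (b.+1 ^ _)%N => x y y0.
by rewrite expnMn [X in (_ <= X)%N]mulSn mulnA -add1n leq_add2r expn_gt0 y0.
Qed.

Section Asymptotics.
Variable R : realType.
Implicit Types eps : R.

(* [W D * Q] is the exponent lost by passing to a popular fiber; it does not
   depend on [d]. *)
Lemma exponents_near_two (r Q : nat) (W : nat -> nat) (eps : R) : 0 < eps ->
  exists D d, [/\ (1 < D)%N, (0 < d)%N &
    (2 - eps) * (d * D.+1 ^ r)%:R <= (d * D.+1 ^ r)%:R + (d * D ^ r)%:R - (W D * Q)%:R].
Proof.
move=> eps0.
(* Half of [eps] pays for the gap between [D ^ r] and [D.+1 ^ r]; the other half pays for the fiber,
   with [d] chosen after [D]. *)
have [D hD] : exists D : nat, (r%:R * 2) / eps < D%:R.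
  by exists (Num.truncn ((r%:R * 2) / eps)).+1; rewrite truncnS_gt.
have [d hd] : exists d : nat, ((W D.+2 * Q)%:R * 2) / eps < d%:R.
  by exists (Num.truncn (((W D.+2 * Q)%:R * 2) / eps)).+1; rewrite truncnS_gt.
exists D.+2, d.+1; split=> //.
have := bernoulli_nat D.+2 r; rewrite -(ler_nat R) natrD !natrM.
move: hD hd; rewrite !ltr_pdivrMr //.
have : (1 : R) <= (D.+3 ^ r)%:R by rewrite ler1n expn_gt0.
rewrite !natrM; move: (D.+3 ^ r)%:R (D.+2 ^ r)%:R => x y x1 hD hd.
have -> : D.+3%:R = D%:R + 3 :> R by rewrite -natrD addn3.
have -> : d.+1%:R = d%:R + 1 :> R by rewrite -natr1.
move: (W D.+2)%:R Q%:R r%:R hD hd (ler0n R D) (ler0n R d) => w q s.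
move: D%:R d%:R => D' d' hD hd D0 d0 ber.
have h1 : x - y <= x * eps / 2.
  have ex : 0 <= eps * x by apply: mulr_ge0; lra.
  have sx : s * x <= (D' * eps / 2) * x by apply: ler_wpM2r; lra.
  have : (x - y) * (D' + 3) <= (x * eps / 2) * (D' + 3) by lra.
  by rewrite ler_pM2r //; lra.
have h2 : w * q <= (d' + 1) * x * eps / 2.
  have dx : (d' + 1) * eps * 1 <= (d' + 1) * eps * x.
    by apply: ler_wpM2l => //; apply: mulr_ge0; lra.
  by lra.
have h3 : (d' + 1) * (x - y) <= (d' + 1) * (x * eps / 2) by apply: ler_wpM2l => //; lra.
by lra.
Qed.

Lemma ln_turan_ge (r e : nat) (eps : R) : (3 <= r)%N -> e \in [:: 4; 5; 7; 8]%N ->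
  0 < eps -> eps <= 1 ->
  \forall n \near \oo, (0 < turan r n (e * (r - 2) + 3) e)%N /\
    (2 - eps) * ln n%:R <= ln (turan r n (e * (r - 2) + 3) e)%:R :> R.
Proof.
move=> r3 he eps0 eps1.
have eps20 : 0 < eps / 2 by apply: divr_gt0.
have [D [d [D1 d0]]] := @exponents_near_two r (r.+4 ^ r) (fun D => 2 * (r * D ^ r.+4).+1)%N _ eps20.
have bound n := @turan_bound r e D d n r3 he D1 d0; move: bound.
move: (d * D.+1 ^ r)%N (d * D ^ r)%N (2 * _)%N (r.+4 ^ r)%N (d * (D ^ r) ^ 2)%N => G G' W Q K bound exponents.
pose A : R := ln r%:R + G%:R * ln 4.
have A0 : 0 <= A by rewrite addr_ge0 ?mulr_ge0 ?ln_ge0 ?ler1n // ltnW // ltnW.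
(* [C] collects all terms free of [n]. The exponents cost [eps / 2], and [n] is taken so large that
   [C] is at most [eps / 2 * ln n]. *)
pose C : R := 2 * A + Q%:R * ln K.+1%:R.
pose N := maxn (r * 3 ^ G) (Num.truncn (expR (C * 2 / eps))).+1.
exists N => // n /=; rewrite geq_max => /andP[n3 nC].
have [T [T0 nT] Tt] := bound n n3; move: Tt.
move: (turan _ _ _ _) => t Tt.
have t0 : (0 < t)%N.
  by rewrite lt0n; apply: contraTneq Tt => ->; rewrite mul0n -ltnNge expn_gt0 T0.
split=> //.
have posn k : (0 < k)%N -> k%:R \is @Num.pos R by rewrite posrE ltr0n.
have n0 : (0 < n)%N by apply: leq_trans nC.
have x0 : 0 <= ln T%:R :> R by rewrite ln_ge0 // ler1n.
have lnn : C * 2 / eps <= ln n%:R :> R.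
  rewrite -[leLHS]expRK ler_ln ?posrE ?expR_gt0 ?ltr0n //.
  by rewrite ltW // (lt_le_trans (truncnS_gt _)) // ler_nat.
have h1 : (G + G')%:R * ln T%:R <= ln t%:R + Q%:R * (ln K.+1%:R + W%:R * ln T%:R) :> R.
  have : ln (T ^ (G + G'))%:R <= ln (t * (K.+1 * T ^ W) ^ Q)%:R :> R.
    rewrite ler_ln ?ler_nat // posn // ?expn_gt0 ?T0 //.
    by rewrite muln_gt0 t0 expn_gt0 muln_gt0 expn_gt0 T0.
  rewrite natrM !natrX natrM natrX lnM ?posrE ?exprn_gt0 ?mulr_gt0 ?exprn_gt0 ?ltr0n //.
  rewrite !lnXn ?mulr_gt0 ?exprn_gt0 ?ltr0n // lnM ?posrE ?exprn_gt0 ?ltr0n // lnXn ?ltr0n //.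
  by rewrite -[_ *+ (G + G')]mulr_natl -[_ *+ Q]mulr_natl -[_ *+ W]mulr_natl.
have h2 : ln n%:R <= A + G%:R * ln T%:R :> R.
  have : ln n%:R <= ln (r * (4 * T) ^ G)%:R :> R.
    rewrite ler_ln ?ler_nat ?(ltnW nT) // posn //.
    by apply: leq_trans nT.
  rewrite natrM natrX natrM lnM ?posrE ?exprn_gt0 ?mulr_gt0 ?ltr0n // ?(ltnW (ltnW r3)) //.
  rewrite lnXn ?mulr_gt0 ?ltr0n // lnM ?posrE ?ltr0n // -[_ *+ G]mulr_natl /A.
  by rewrite mulrDr addrA.
have h3 : (2 - eps / 2) * G%:R * ln T%:R <= (G%:R + G'%:R - (W * Q)%:R) * ln T%:R :> R.
  by apply: ler_wpM2r.
have h4 : (2 - eps / 2) * ln n%:R <= (2 - eps / 2) * (A + G%:R * ln T%:R) :> R.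
  by apply: ler_wpM2l => //; lra.
have h5 : 0 <= eps / 2 * A by rewrite mulr_ge0 // ltW.
move: lnn; rewrite ler_pdivrMr // /C => lnn.
move: h1 h3; rewrite natrD natrM => h1 h3.
lra.
Qed.

End Asymptotics.

Theorem theorem5 (R : realType) (r e : nat) (hr : (3 <= r)%N)
    (he : e \in [:: 4; 5; 7; 8]%N) :
  exists eps : nat -> R,
    (eps n @[n --> \oo] --> (0 : R)) /\
    (\forall n \near \oo,
       n%:R `^ (2 - eps n) < (turan r n (e * (r - 2) + 3)%N e)%:R).
Proof.
pose t n := turan r n (e * (r - 2) + 3) e.
pose gap n : R := 2 - ln (t n)%:R / ln n%:R.
(* [gap] is the exact deficit of the exponent, known only to be eventually small from above; the
   maximum bounds it below, and the positive [harmonic n] makes the inequality strict. *)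
exists (fun n => Num.max 0 (gap n) + harmonic n); split.
  rewrite -[X in _ --> X](addr0 0); apply: cvgD; last exact: cvg_harmonic.
  apply/cvgrPdist_le => /= a a0.
  have m0 : 0 < Num.min a 1 by rewrite lt_min a0 ltr01.
  have m1 : Num.min a 1 <= 1 by rewrite ge_min lexx orbT.
  near=> n.
  have [_ le_ln] : (0 < t n)%N /\ (2 - Num.min a 1) * ln n%:R <= ln (t n)%:R :> R.
    by near: n; apply: ln_turan_ge.
  have ln_gt0 : 0 < ln n%:R :> R.
    by apply: ln_gt0; rewrite ltr1n; near: n; exact: nbhs_infty_gt.
  rewrite sub0r normrN ger0_norm ?le_max ?lexx // ge_max (ltW a0) /=.
  have : 2 - Num.min a 1 <= ln (t n)%:R / ln n%:R by rewrite ler_pdivlMr.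
  have : Num.min a 1 <= a by rewrite ge_min lexx.
  by rewrite /gap; lra.
near=> n.
have [t0 _] : (0 < t n)%N /\ (2 - 1) * ln n%:R <= ln (t n)%:R :> R.
  by near: n; apply: ln_turan_ge.
have n1 : (1 < n)%N by near: n; exact: nbhs_infty_gt.
have ln_n0 : 0 < ln n%:R :> R by apply: ln_gt0; rewrite ltr1n.
rewrite /powR pnatr_eq0 -[n == 0%N]negbK -lt0n (ltnW n1) /= -[ltRHS]lnK ?posrE ?ltr0n //.
rewrite ltr_expR -ltr_pdivlMr //.
have : gap n <= Num.max 0 (gap n) by rewrite le_max lexx orbT.
have : 0 < harmonic n :> R by rewrite /harmonic /= invr_gt0.
rewrite /gap /harmonic /= -/(t n).
by move: (_ / _) (_^-1) (Num.max _ _) => x y z; lra.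
Unshelve. all: by end_near.
Qed.
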